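(* Let \[B(t,x,y)=\sum_{n\ge 0}\ \sum_{\pi\in \mathfrak{S}_n^{[3]}(231)} t^{c_1(\pi)}x^{c_2(\pi)}y^{c_3(\pi)}.\] Then \[ B(t,x,y) = \dfrac{(1-x)^2(1-2y)}{1 - 3 x - 3 y - t + 2 x^2 + 5 x y + t x - 5 x^2 y - 4 t x y - t^2y}. \]
   Context: $\mathfrak{S}_n$ is the symmetric group on $[n]=\{1,\dots,n\}$; permutations are written in one-line notation $\pi=\pi_1\cdots\pi_n$ with $\pi_i=\pi(i)$. A permutation $\pi$ contains a pattern $\sigma\in\mathfrak{S}_k$ if some subsequence of $\pi_1\cdots\pi_n$ of length $k$ is in the same relative order as $\sigma$; otherwise $\pi$ avoids $\sigma$. $\mathfrak{S}_n^{[3]}(231)$ is the set of permutations in $\mathfrak{S}_n$ that avoid $231$ and all of whose cycles (in the disjoint cycle decomposition) have length $1$, $2$ or $3$; $\mathfrak{S}_0^{[3]}(231)$ consists of the empty permutation. $c_k(\pi)$ denotes the number of $k$-cycles of $\pi$. *)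

(* Defs.v *)
From mathcomp Require Import all_boot all_order all_algebra all_fingroup.
Set Implicit Arguments. Unset Strict Implicit. Unset Printing Implicit Defensive.
Import GRing.Theory.
Local Open Scope ring_scope.

Definition contains231 (n : nat) (s : 'S_n) : bool :=
  [exists i : 'I_n, exists j : 'I_n, exists k : 'I_n,
     [&& (i < j)%N, (j < k)%N, (s k < s i)%N & (s i < s j)%N]].

Definition avoids231 (n : nat) (s : 'S_n) : bool := ~~ contains231 s.

(* c_k(pi): number of k-cycles of pi (cycles = porbits, fixed points included) *)
Definition ncycles (k n : nat) (s : 'S_n) : nat :=
  #|[set C in porbits s | #|C| == k]|.

Definition cycles_le3 (n : nat) (s : 'S_n) : bool :=
  [forall C in porbits s, (1 <= #|C| <= 3)%N].

Definition in_S3_231 (n : nat) (s : 'S_n) : bool := avoids231 s && cycles_le3 s.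

(* F a b c is the coefficient of t^a x^b y^c *)
Definition ps := nat -> nat -> nat -> int.

Definition ps_const (r : int) : ps :=
  fun a b c => if [&& a == 0%N, b == 0%N & c == 0%N] then r else 0.
Definition ps_t : ps := fun a b c => if [&& a == 1%N, b == 0%N & c == 0%N] then 1 else 0.
Definition ps_x : ps := fun a b c => if [&& a == 0%N, b == 1%N & c == 0%N] then 1 else 0.
Definition ps_y : ps := fun a b c => if [&& a == 0%N, b == 0%N & c == 1%N] then 1 else 0.
Definition ps_add (F G : ps) : ps := fun a b c => F a b c + G a b c.
Definition ps_sub (F G : ps) : ps := fun a b c => F a b c - G a b c.
Definition ps_mul (F G : ps) : ps := fun a b c =>
  \sum_(i < a.+1) \sum_(j < b.+1) \sum_(k < c.+1)
     F i j k * G (a - i)%N (b - j)%N (c - k)%N.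

Declare Scope ps_scope.
Delimit Scope ps_scope with PS.
Notation "F + G" := (ps_add F G) : ps_scope.
Notation "F - G" := (ps_sub F G) : ps_scope.
Notation "F * G" := (ps_mul F G) : ps_scope.
Notation "r %:S" := (ps_const r) (at level 2, format "r %:S") : ps_scope.

(* B(t,x,y) = sum_{n>=0} sum_{pi in S_n^{[3]}(231)} t^{c1} x^{c2} y^{c3}.
   For such pi, n = c1 + 2 c2 + 3 c3, so the coefficient of t^a x^b y^c
   only receives contributions from n = a + 2b + 3c. *)
Definition Bcoef (a b c : nat) : nat :=
  #|[set s : 'S_(a + 2 * b + 3 * c) |
      [&& in_S3_231 s, ncycles 1 s == a, ncycles 2 s == b & ncycles 3 s == c]]|.

Definition B : ps := fun a b c => (Bcoef a b c)%:Z.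

Definition Bnum : ps :=
  ((1%:S - ps_x) * (1%:S - ps_x) * (1%:S - 2%:S * ps_y))%PS.

Definition Bden : ps :=
  (1%:S - 3%:S * ps_x - 3%:S * ps_y - ps_t + 2%:S * ps_x * ps_x
   + 5%:S * ps_x * ps_y + ps_t * ps_x - 5%:S * ps_x * ps_x * ps_y
   - 4%:S * ps_t * ps_x * ps_y - ps_t * ps_t * ps_y)%PS.

(* Main.v *)
(** A 231-avoiding permutation is a direct sum [u (+) v] in which [v] is
    nonempty and starts with its maximum.  When all cycles have length at most
    3, such a block [v] is either decreasing or contains the 3-cycle
    0 -> n-1 -> p+1 -> 0 through its first and last positions.  Deleting this
    3-cycle leaves a smaller good permutation [w] together with the gap [p];
    the block avoids 231 iff [w] does, the first [p] entries of [w] decrease,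
    and the values [>= p] of [w] appear in decreasing order.  Such a pair
    [(w, p)] is of one of three kinds: [w] is decreasing and [p] is arbitrary;
    [w] is the direct sum of two nonempty decreasing permutations, the first of
    size [p]; or [w] is itself obtained by adding a 3-cycle with gap [q] and [p]
    is [q+1] or [q+2].  With [R], [M], [D], [J] the generating functions of
    decreasing permutations, decreasing permutations with a gap, pairs and
    blocks, this gives
      B = 1 + B J,   J = R - 1 + y D,   D = M + (R-1)^2 + 2 y D,
      R = 1 + t + x R,   M = 1 + 2 t + x (M + 2 R),
    a system whose solution is the stated rational function. *)

Require Import Defs.
From mathcomp Require Import all_boot all_order all_algebra all_fingroup.
From mathcomp Require Import zify.
From Stdlib Require Import FunctionalExtensionality Ring.
Set Implicit Arguments. Unset Strict Implicit. Unset Printing Implicit Defensive.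

Import GRing.Theory.

(** * Words, cycle lengths and 231-avoidance *)

(* [0] encodes a cycle of length greater than 3. *)
Definition cycle_length3 (f : nat -> nat) (i : nat) : nat :=
  if f i == i then 1 else if f (f i) == i then 2
  else if f (f (f i)) == i then 3 else 0.

Lemma cycle_length3_lt f i : cycle_length3 f i < 4.
Proof. by rewrite /cycle_length3; case: ifP => // _; case: ifP => // _; case: ifP. Qed.

Lemma cycle_length3_embed (e f g : nat -> nat) i : injective e ->
    f (e i) = e (g i) -> f (e (g i)) = e (g (g i)) ->
    f (e (g (g i))) = e (g (g (g i))) ->
  cycle_length3 f (e i) = cycle_length3 g i.
Proof. by move=> inj h1 h2 h3; rewrite /cycle_length3 h1 h2 h3 !(inj_eq inj). Qed.

(** Points are counted instead of cycles, so no orbit has to be built: for k = 1, 2, 3 this is k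
    times the number of k-cycles. [npoints 0 w = 0] says that no cycle is longer than 3. *)
Definition npoints (k : nat) (w : seq nat) : nat :=
  count (fun i => cycle_length3 (nth 0 w) i == k) (iota 0 (size w)).

Lemma npoints_sum w :
  npoints 0 w + npoints 1 w + npoints 2 w + npoints 3 w = size w.
Proof.
rewrite /npoints -[RHS](size_iota 0); elim: (iota 0 _) => //= i s IH.
by have := cycle_length3_lt (nth 0 w) i; case: (cycle_length3 _ i) => [|[|[|[|]]]] //=; lia.
Qed.

(** Common source of the cycle counts for direct sums, inserted 3-cycles and decreasing words: [e]
    carries a copy of [w'] into [w], as positions and as values, and only the remaining positions
    [s] are left to inspect. *)
Lemma npoints_embed (e : nat -> nat) w w' s k : injective e ->
    perm_eq (iota 0 (size w)) (s ++ map e (iota 0 (size w'))) ->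
    (forall i, i < size w' -> nth 0 w' i < size w') ->
    (forall i, i < size w' -> nth 0 w (e i) = e (nth 0 w' i)) ->
  npoints k w = count (fun i => cycle_length3 (nth 0 w) i == k) s + npoints k w'.
Proof.
move=> inj hp hlt he; rewrite /npoints (seq.permP hp) count_cat count_map; congr (_ + _).
apply: eq_in_count => i; rewrite mem_iota add0n => /andP[_ hi] /=.
by rewrite (@cycle_length3_embed e _ (nth 0 w')) // he ?hlt.
Qed.

(** The letters [x], [y], [z] play the roles of 2, 3, 1, the pattern being attributed to its first
    letter. *)
Fixpoint av231 (w : seq nat) : bool :=
  if w is x :: s then pairwise (fun y z => ~~ ((z < x) && (x < y))) s && av231 s
  else true.

Lemma av231_map (e : nat -> nat) w :
  {mono e : x y / x < y} -> av231 (map e w) = av231 w.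
Proof.
move=> he; elim: w => //= x s ->; rewrite pairwise_map; congr andb.
by apply: eq_pairwise => y z /=; rewrite !he.
Qed.

(** A leading letter can only be the 2 of a pattern, and no later letter exceeds a maximum to serve
    as the 3. *)
Lemma av231_cons_max x s : all (leq^~ x) s -> av231 (x :: s) = av231 s.
Proof.
move=> /= hx; rewrite -[RHS]andTb; congr andb.
elim: s hx => //= y s IH /andP[hy /IH ->]; rewrite andbT.
by apply/allP => z _; apply/negP; lia.
Qed.

(** The last letter can only be the 1 of a pattern, which exists exactly when two earlier letters
    above [z] ascend. *)
Lemma av231_rcons s z :
  av231 (rcons s z) = av231 s && pairwise geq [seq v <- s | z < v].
Proof.
elim: s => //= x s ->; rewrite -cats1 pairwise_cat allrel1r /= andbT.
have -> : pairwise geq (if z < x then x :: [seq v <- s | z < v] else [seq v <- s | z < v])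
  = all (fun y => ~~ ((z < x) && (x < y))) s && pairwise geq [seq v <- s | z < v].
  case: (ltnP z x) => hzx /=; last by rewrite all_predT.
  by rewrite all_filter; congr andb; apply: eq_all => y /=; lia.
by case: (all _ s); case: (av231 s); case: (pairwise _ s).
Qed.

(** The letter 0 can only be the 1 of a pattern, so it does harm exactly when the positive letters
    before it contain an ascent. *)
Lemma av231_cat_cons0 s1 s2 : all (leq 1) s1 ->
  av231 (s1 ++ 0 :: s2) = av231 (s1 ++ s2) && pairwise geq s1.
Proof.
elim: s1 => [_|x s1 IH] /=.
  rewrite andbT -[RHS]andTb; congr andb.
  by elim: s2 => //= y s2 ->; rewrite andbT; apply/allP.
move=> /andP[hx /IH ->]; rewrite !pairwise_cat /= allrel_consr.
have -> : all (fun z => ~~ ((z < x) && (x < 0))) s2 = true by apply/allP => z; rewrite andbF.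
have -> : all (fun y => ~~ ((0 < x) && (x < y))) s1 = all (geq x) s1.
  by apply: eq_all => y /=; lia.
by case: (all _ s1); rewrite ?andbF //= andbA.
Qed.

(** * Direct sums, insertion of a 3-cycle and decreasing words *)

Definition dsum (u v : seq nat) : seq nat := u ++ map (addn (size u)) v.

(** The increasing map whose image omits exactly 0 and p+1. It renumbers positions and values alike
    when a 3-cycle through 0, p+1 and the new last position is inserted. *)
Definition skip (p v : nat) : nat := if v < p then v.+1 else v.+2.

(* In one-line notation (shifted to start at 0), the permutation obtained from
   [w] by adding the 3-cycle 0 -> |w|+2 -> p+1 -> 0. *)
Definition ext (w : seq nat) (p : nat) : seq nat :=
  (size w).+2 :: map (skip p) (take p w) ++ 0 :: rcons (map (skip p) (drop p w)) p.+1.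

Definition revw (n : nat) : seq nat := rev (iota 0 n).

Definition isperm (w : seq nat) := perm_eq w (iota 0 (size w)).

(** The first condition comes from the letter 0 inserted by [ext] after the first [p] letters of
    [w], the second from the inserted last letter p+1. *)
Definition pair_cond (w : seq nat) (p : nat) :=
  pairwise geq (take p w) && pairwise geq [seq v <- w | p <= v].

Lemma skip_mono p : {mono skip p : x y / x < y}.
Proof. by move=> x y; rewrite /skip; case: ifP => ?; case: ifP => ?; lia. Qed.

Lemma skip_inj p : injective (skip p).
Proof. by move=> x y; rewrite /skip; case: ifP => ?; case: ifP => ?; lia. Qed.

Lemma skip_gt p v : (p.+1 < skip p v) = (p <= v).
Proof. by rewrite /skip; case: ifP => ?; lia. Qed.

Lemma skip_gt0 p v : 0 < skip p v.
Proof. by rewrite /skip; case: ifP => ?; lia. Qed.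

Lemma isperm_lt w v : isperm w -> v \in w -> v < size w.
Proof. by move=> /perm_mem -> ; rewrite mem_iota. Qed.

Lemma isperm_mem w v : isperm w -> (v \in w) = (v < size w).
Proof. by move=> /perm_mem -> ; rewrite mem_iota. Qed.

Lemma isperm_uniq w : isperm w -> uniq w.
Proof. by move=> /perm_uniq ->; rewrite iota_uniq. Qed.

Lemma isperm_nth w i : isperm w -> i < size w -> nth 0 w i < size w.
Proof. by move=> hw hi; apply: isperm_lt => //; apply: mem_nth. Qed.

Lemma isperm_intro w : uniq w -> (forall v, v \in w -> v < size w) -> isperm w.
Proof.
move=> uw hw; apply: uniq_perm; rewrite ?iota_uniq //.
have sub : {subset w <= iota 0 (size w)} by move=> v /hw; rewrite mem_iota.
by have [] := uniq_min_size uw sub; rewrite ?size_iota.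
Qed.

Lemma pairwise_geq_map (e : nat -> nat) s : {mono e : x y / x < y} ->
  pairwise geq (map e s) = pairwise geq s.
Proof.
move=> he; rewrite pairwise_map; apply: eq_pairwise => x y /=.
by rewrite leqNgt he -leqNgt.
Qed.

Lemma size_ext w p : p <= size w -> size (ext w p) = (size w).+3.
Proof.
by move=> hp; rewrite /ext /= size_cat /= size_rcons !size_map size_take_min size_drop; lia.
Qed.

Lemma filter_skip p s :
  [seq v <- map (skip p) s | p.+1 < v] = map (skip p) [seq v <- s | p <= v].
Proof. by rewrite filter_map; congr map; apply: eq_filter => v /=; rewrite skip_gt. Qed.

(** The inserted letters are removed in turn: the leading maximum is harmless, the last letter
    requires the values above it to decrease, and the 0 requires the letters before it to decrease.
    What remains is an order-isomorphic copy of [w]. *)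
Lemma ext_av231 w p : isperm w -> p <= size w ->
  av231 (ext w p) = av231 w && pair_cond w p.
Proof.
move=> hw hp; rewrite /ext av231_cons_max; last first.
  rewrite all_cat /= all_rcons !all_map /=; apply/and3P; split.
  - by apply/allP => v /mem_take /(isperm_lt hw) /=; rewrite /skip; case: ifP => _; lia.
  - by lia.
  - by apply/allP => v /mem_drop /(isperm_lt hw) /=; rewrite /skip; case: ifP => _; lia.
rewrite -rcons_cons -rcons_cat av231_rcons av231_cat_cons0; last first.
  by apply/allP => _ /mapP[v _ ->]; apply: skip_gt0.
rewrite filter_cat /= !filter_skip -!map_cat -filter_cat !cat_take_drop.
by rewrite av231_map ?pairwise_geq_map ?/pair_cond ?andbA //; apply: skip_mono.
Qed.

Lemma ext_perm w p : isperm w -> p <= size w ->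
  perm_eq (ext w p) [:: 0, p.+1, (size w).+2 & map (skip p) w].
Proof.
move=> hw hp; rewrite -{3}(cat_take_drop p w) map_cat /ext.
set u := map _ _; set v := map _ _.
apply/seq.permP => P; rewrite /= !count_cat /= -cats1 count_cat /=; lia.
Qed.

Lemma ext_isperm w p : isperm w -> p <= size w -> isperm (ext w p).
Proof.
move=> hw hp; have hpe := ext_perm hw hp.
apply: isperm_intro.
  rewrite (perm_uniq hpe) /= (map_inj_uniq (@skip_inj p)) isperm_uniq // andbT !inE.
  apply/and3P; split.
  - rewrite !negb_or /=; apply/mapP => -[v _]; have := skip_gt0 p v; lia.
  - rewrite negb_or; apply/andP; split; first by lia.
    by apply/mapP => -[v _]; rewrite /skip; case: ifP; lia.
  - by apply/mapP => -[v /(isperm_lt hw)]; rewrite /skip; case: ifP; lia.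
move=> v; rewrite (perm_mem hpe) size_ext // !inE => /or4P[/eqP->|/eqP->|/eqP->|]; try lia.
by move=> /mapP[u /(isperm_lt hw) hu ->]; rewrite /skip; case: ifP; lia.
Qed.

Lemma nth_ext0 w p : nth 0 (ext w p) 0 = (size w).+2. Proof. by []. Qed.

Lemma nth_ext_mid w p : p <= size w -> nth 0 (ext w p) p.+1 = 0.
Proof.
by move=> hp; rewrite /ext /= nth_cat size_map size_takel // ltnn subnn.
Qed.

Lemma nth_ext_last w p : p <= size w -> nth 0 (ext w p) (size w).+2 = p.+1.
Proof.
move=> hp; have := size_ext hp; rewrite /ext => hs.
have -> : (size w).+2 = (size (ext w p)).-1 by rewrite size_ext.
by rewrite nth_last /ext /= last_cat /= last_rcons.
Qed.

Lemma nth_ext_skip w p i : p <= size w -> i < size w ->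
  nth 0 (ext w p) (skip p i) = skip p (nth 0 w i).
Proof.
move=> hp hi; rewrite {1}/skip /ext; case: (ltnP i p) => h /=.
  rewrite nth_cat size_map size_takel // h (nth_map 0) ?size_takel //.
  by rewrite nth_take.
rewrite nth_cat size_map size_takel // ltnNge (leqW h) /= subSn //= nth_rcons.
rewrite size_map size_drop ltn_sub2r ?(leq_ltn_trans h) //.
rewrite (nth_map 0) ?size_drop ?ltn_sub2r ?(leq_ltn_trans h) //.
by rewrite nth_drop subnKC.
Qed.

(** The positions 0, p+1 and |w|+2 form one 3-cycle, and [skip p] embeds the cycles of [w] in the
    other positions. *)
Lemma ext_npoints w p k : isperm w -> p <= size w ->
  npoints k (ext w p) = npoints k w + 3 * (k == 3).
Proof.
move=> hw hp.
have hs : perm_eq (iota 0 (size (ext w p)))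
   ([:: 0; p.+1; (size w).+2] ++ map (skip p) (iota 0 (size w))).
  rewrite -(seq.permPl (ext_isperm hw hp)) (seq.permPl (ext_perm hw hp)) /= !perm_cons.
  exact: perm_map.
rewrite (npoints_embed k (@skip_inj p) hs); first 1 last.
- by move=> i; apply: isperm_nth.
- by move=> i; apply: nth_ext_skip.
rewrite addnC; congr (_ + _); rewrite /count /cycle_length3.
rewrite !(nth_ext0, nth_ext_mid hp, nth_ext_last hp) /= !eqSS !eqxx.
have -> : ((size w).+1 == p) = false by lia.
have -> : (p == (size w).+1) = false by lia.
by rewrite /= eq_sym; case: (3 == k).
Qed.

Lemma size_dsum u v : size (dsum u v) = size u + size v.
Proof. by rewrite /dsum size_cat size_map. Qed.

Lemma dsum_isperm u v : isperm u -> isperm v -> isperm (dsum u v).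
Proof.
move=> hu hv; rewrite /isperm size_dsum /dsum iotaD add0n.
apply: perm_cat => //; rewrite -[X in iota X _]addn0 iotaDl; exact: perm_map.
Qed.

Lemma dsum_npoints u v k : isperm u -> isperm v ->
  npoints k (dsum u v) = npoints k u + npoints k v.
Proof.
move=> hu hv.
have hs : perm_eq (iota 0 (size (dsum u v)))
    (iota 0 (size u) ++ map (addn (size u)) (iota 0 (size v))).
  by rewrite size_dsum iotaD add0n -iotaDl addn0.
rewrite (npoints_embed k (@addnI (size u)) hs); first 1 last.
- by move=> i; apply: isperm_nth.
- by move=> i hi; rewrite /dsum nth_cat ltnNge leq_addr /= addKn (nth_map 0).
congr (_ + _); apply: eq_in_count => i; rewrite mem_iota add0n => /andP[_ hi].
have hn j : j < size u -> nth 0 (dsum u v) j = nth 0 u j.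
  by move=> hj; rewrite /dsum nth_cat hj.
have h1 := isperm_nth hu hi; have h2 := isperm_nth hu h1.
by rewrite /cycle_length3 !hn.
Qed.

(** The 1 of a pattern comes last and lies below the 2, so a 2 in [u] forces the whole pattern into
    [u]. *)
Lemma av231_cat_lt u v : allrel ltn u v -> av231 (u ++ v) = av231 u && av231 v.
Proof.
elim: u => //= x u IH; rewrite allrel_consl => /andP[hx huv].
rewrite (IH huv) pairwise_cat.
have -> : allrel (fun y z => ~~ ((z < x) && (x < y))) u v = true.
  by apply/allrelP => y z _ /(allP hx) /= ?; apply/negP; lia.
have -> : pairwise (fun y z => ~~ ((z < x) && (x < y))) v = true.
  elim: v {huv} hx {IH} => //= y v IH /andP[hy hv]; rewrite IH // andbT.
  by apply/allP => z /(allP hv) /= ?; apply/negP; lia.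
by rewrite andbT andbA.
Qed.

Lemma allrel_ltn_shift u v : isperm u -> allrel ltn u (map (addn (size u)) v).
Proof.
move=> hu; apply/allrelP => x y /(isperm_lt hu) hx /mapP[z _ ->] /=; lia.
Qed.

Lemma dsum_av231 u v : isperm u -> av231 (dsum u v) = av231 u && av231 v.
Proof.
move=> hu; rewrite /dsum av231_cat_lt ?av231_map //; first by move=> x y; rewrite ltn_add2l.
exact: allrel_ltn_shift.
Qed.

Lemma size_revw n : size (revw n) = n.
Proof. by rewrite size_rev size_iota. Qed.

Lemma revw_isperm n : isperm (revw n).
Proof. by rewrite /isperm size_revw /revw perm_rev. Qed.

Lemma revw_dec n : pairwise geq (revw n).
Proof.
by rewrite -sorted_pairwise ?rev_sorted ?iota_sorted // => x y z /= h1 h2; apply: leq_trans h2 h1.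
Qed.

Lemma dec_revw w : isperm w -> pairwise geq w -> w = revw (size w).
Proof.
have htr : transitive geq by move=> x y z /= h1 h2; apply: leq_trans h2 h1.
move=> hw hd; apply: (@sorted_eq _ geq) => //.
- by move=> x y /=; lia.
- by rewrite sorted_pairwise.
- by rewrite sorted_pairwise ?revw_dec.
- by rewrite /revw; apply: perm_trans hw _; rewrite perm_sym perm_rev.
Qed.

Lemma revw_av231 n : av231 (revw n).
Proof.
have := revw_dec n; elim: (revw n) => //= x s IH /andP[hx /IH ->]; rewrite andbT.
elim: s hx {IH} => //= y s IH /andP[hy /IH ->]; rewrite andbT.
by apply/allP => z _; apply/negP; move: hy; rewrite /geq /=; lia.
Qed.

Lemma nth_revw n i : i < n -> nth 0 (revw n) i = n - i.+1.
Proof. by move=> hi; rewrite /revw nth_rev size_iota // nth_iota ?add0n //; lia. Qed.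

(** The first and last positions are exchanged, and the inner positions carry [revw n] shifted by
    one. *)
Lemma revw_npointsSS n k : npoints k (revw n.+2) = npoints k (revw n) + 2 * (k == 2).
Proof.
have hs : perm_eq (iota 0 (size (revw n.+2)))
   ([:: 0; n.+1] ++ map succn (iota 0 (size (revw n)))).
  rewrite !size_revw (_ : map succn _ = iota 1 n); last by rewrite (iotaDl 1 0).
  have -> : iota 0 n.+2 = 0 :: rcons (iota 1 n) n.+1.
    by rewrite -cats1 -[_ :: _]/(iota 0 1 ++ iota 1 n ++ iota (1 + n) 1) -!iotaD addn1.
  by rewrite perm_cons perm_rcons.
rewrite (npoints_embed k succn_inj hs); first 1 last.
- by move=> i; apply: isperm_nth (revw_isperm n).
- by move=> i; rewrite size_revw => hi; rewrite !nth_revw //; lia.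
have h0 : nth 0 (revw n.+2) 0 = n.+1 by rewrite nth_revw ?subn1.
have h1 : nth 0 (revw n.+2) n.+1 = 0 by rewrite nth_revw ?subnn.
rewrite addnC; congr (_ + _); rewrite /count /cycle_length3 !(h0, h1) /=.
by rewrite eqxx eq_sym; case: (2 == k).
Qed.

Lemma revw_npoints0 n : npoints 0 (revw n) = 0.
Proof.
have [m] := ubnP n; elim: m n => // m IH [|[|n]] // hn.
by rewrite revw_npointsSS IH //; lia.
Qed.

(** * Decomposition of good words *)

Lemma av231_cat_cons u x v a c :
  av231 (u ++ x :: v) -> a \in u -> c \in v -> ~~ ((c < a) && (a < x)).
Proof.
elim: u => //= b u IH /andP[hb hu]; rewrite inE => /predU1P[-> hc|]; last exact: IH.
move: hb; rewrite pairwise_cat /= => /and4P[_ _ /allP h _]; exact: h.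
Qed.

(** Sorting the two parts separately already sorts the whole word, which gives the interval from 0.
    Cutting that interval at the size of [u] shows which values each part holds. *)
Lemma isperm_cat_lt u v : isperm (u ++ v) -> allrel ltn u v ->
  isperm u /\ exists2 v', v = map (addn (size u)) v' & isperm v'.
Proof.
move=> hp hlt.
have htot := leq_total.
have hs : sort leq u ++ sort leq v = iota 0 (size u) ++ iota (size u) (size v).
  rewrite -[X in _ ++ iota X _]add0n -iotaD.
  apply: (@sorted_eq _ leq) => //; first exact: leq_trans.
  - exact: anti_leq.
  - rewrite sorted_pairwise; last exact: leq_trans.
    rewrite pairwise_cat -!sorted_pairwise; try exact: leq_trans.
    rewrite !sort_sorted // !andbT; apply/allrelP => x y.
    by rewrite !mem_sort => hx hy; apply: ltnW; apply: (allrelP hlt).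
  - exact: iota_sorted.
  - rewrite -size_cat; apply: perm_trans hp; apply: perm_cat; exact/permEl/perm_sort.
move/eqP: hs; rewrite eqseq_cat ?size_sort ?size_iota // => /andP[/eqP hu /eqP hv].
have hu' : isperm u by rewrite /isperm -hu perm_sym; exact/permEl/perm_sort.
have hv' : perm_eq v (iota (size u) (size v)) by rewrite -hv perm_sym; exact/permEl/perm_sort.
split=> //; exists (map (subn^~ (size u)) v).
  rewrite -map_comp map_id_in // => x; rewrite (perm_mem hv') mem_iota /= => ?; lia.
rewrite /isperm size_map; apply: (@perm_trans _ (map (subn^~ (size u)) (iota (size u) (size v)))).
  exact: perm_map.
rewrite -[X in iota X (size v)]addn0 iotaDl -map_comp map_id_in // => x _ /=; lia.
Qed.

Lemma mem_cat_cons (T : eqType) (x : T) s : x \in s -> exists u v, s = u ++ x :: v.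
Proof. by case/splitPr => u v; exists u, v. Qed.

(** The cut is just before the maximum: a letter before it and a smaller one after it would form 231
    with it, so every letter before the cut lies below every letter after. *)
Lemma isperm_max_decomp w : isperm w -> av231 w -> w != [::] ->
  exists u v, [/\ w = dsum u v, isperm u, isperm v, v != [::] & head 0 v = (size v).-1].
Proof.
move=> hw hav w0.
have w0' : 0 < size w by rewrite lt0n size_eq0.
have [u [v e]] : exists u v, w = u ++ (size w).-1 :: v.
  by apply: mem_cat_cons; rewrite isperm_mem // prednK.
have hs : size w = size u + (size v).+1 by rewrite {1}e size_cat.
have := isperm_uniq hw; rewrite e cat_uniq /= negb_or => /and4P[_ /andP[hnu hvu] _ _].
have hlt : allrel ltn u ((size w).-1 :: v).
  have hb a : a \in u -> a < (size w).-1.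
    move=> ha; have : a < size w by apply: isperm_lt => //; rewrite e mem_cat ha.
    have : a != (size w).-1 by apply: contraNneq hnu => <-.
    lia.
  apply/allrelP => a c ha; rewrite inE => /predU1P[->|hc]; first exact: hb.
  have := @av231_cat_cons u (size w).-1 v a c; rewrite -e => /(_ hav ha hc).
  rewrite hb // andbT -leqNgt leq_eqVlt => /predU1P[eac|//].
  by case/hasP: hvu; exists c => //; rewrite -eac.
rewrite e in hw; have [hu [v' hv' pv']] := isperm_cat_lt hw hlt.
have hsv : size v' = (size v).+1 by rewrite -(size_map (addn (size u))) -hv'.
exists u, v'; split=> //; first by rewrite /dsum -hv'.
  by rewrite -size_eq0 hsv.
by case: v' hsv hv' {pv'} => //= a v' [hsv] [ha _]; lia.
Qed.

Lemma npoints0P w i : npoints 0 w = 0 -> i < size w -> cycle_length3 (nth 0 w) i != 0.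
Proof.
move/eqP; rewrite /npoints -leqn0 leqNgt -has_count => /hasPn h hi.
by apply: h; rewrite mem_iota.
Qed.

Definition unskip (p v : nat) : nat := if v <= p then v.-1 else v.-2.

Lemma unskipK p v : v != 0 -> v != p.+1 -> skip p (unskip p v) = v.
Proof. by rewrite /skip /unskip => h1 h2; case: (leqP v p) => h; case: ifP; lia. Qed.

(** An extension is recognised by its three special letters: the maximum first, p+1 last, and 0 at
    position p+1. Deleting them and renumbering by [unskip p] recovers [w]. *)
Lemma extP m p s1 : isperm (m.+2 :: rcons s1 p.+1) -> size s1 = m.+1 ->
    nth 0 (m.+2 :: rcons s1 p.+1) p.+1 = 0 ->
  exists w, [/\ isperm w, p <= size w & m.+2 :: rcons s1 p.+1 = ext w p].
Proof.
move=> hp hs1 /=; rewrite nth_rcons hs1; case: ifP => [hpm h0|hpm]; last first.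
  case: eqP => // hpm' _.
  (* Past the end [nth] returns its default 0, so the hypothesis on position p+1 says nothing here;
     the bound on the letters of a permutation excludes the case. *)
  have : p.+1 < size (m.+2 :: rcons s1 p.+1).
    by apply: isperm_lt => //; rewrite inE mem_rcons inE eqxx orbT.
  by rewrite /= size_rcons hs1; lia.
have hsz : size (m.+2 :: rcons s1 p.+1) = m.+3 by rewrite /= size_rcons hs1.
set A := take p s1; set C := drop p.+1 s1.
have e1 : s1 = A ++ 0 :: C by rewrite -h0 -drop_nth ?hs1 // cat_take_drop.
have sA : size A = p by rewrite size_takel // hs1 ltnW.
have sC : size C = m - p by rewrite size_drop hs1.
have hperm : perm_eq (m.+2 :: rcons s1 p.+1) ([:: 0; p.+1; m.+2] ++ A ++ C).
  by apply/seq.permP => P; rewrite -cats1 e1 /= !count_cat /=; lia.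
have hAC v : v \in A ++ C -> [/\ v != 0, v != p.+1 & v < m.+2].
  move=> hv; have := isperm_uniq hp; rewrite (perm_uniq hperm) cat_uniq => /and3P[_ /hasPn/(_ v hv)].
  have := isperm_mem v hp; rewrite hsz (perm_mem hperm) mem_cat hv orbT /= !inE !negb_or.
  by move=> /esym ? /and3P[h1 h2 h3] _; split=> //; lia.
have hK s : {subset s <= A ++ C} -> map (skip p) (map (unskip p) s) = s.
  by move=> hs; rewrite -map_comp map_id_in // => v /hs /hAC[h1 h2 _] /=; rewrite unskipK.
set w := map (unskip p) (A ++ C).
have sw : size w = m by rewrite size_map size_cat sA sC; lia.
exists w; split.
- apply: isperm_intro.
    apply: (@map_uniq _ _ (skip p)); rewrite hK //.
    by have := isperm_uniq hp; rewrite (perm_uniq hperm) cat_uniq => /and3P[].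
  by move=> _ /mapP[v /hAC[h1 h2 h3] ->]; rewrite sw /unskip; case: ifP; lia.
- by rewrite sw.
- rewrite /ext sw /w map_cat take_size_cat ?size_map // drop_size_cat ?size_map //.
  rewrite !hK; try by move=> v hv; rewrite mem_cat hv ?orbT.
  by rewrite {1}e1 rcons_cat.
Qed.

(** Position 0 is sent to the last position, and from there to the last letter [z]. If [z] is 0,
    avoidance makes all letters before it decrease; otherwise the cycle must close at the third
    step, so 0 stands at position [z] and [extP] applies. *)
Lemma block_cases w : isperm w -> av231 w -> npoints 0 w = 0 -> w != [::] ->
    head 0 w = (size w).-1 ->
  w = revw (size w) \/ exists u p, [/\ isperm u, p <= size u & w = ext u p].
Proof.
case: w => // x s hw hav h0 _ /= hx.
case/lastP: s => [|s z] in hw hav h0 hx *.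
  by left; rewrite /revw /=; move: hx => /= ->.
rewrite /= size_rcons /= in hx.
have hlast : nth 0 (x :: rcons s z) x = z.
  by rewrite hx /= nth_rcons ltnn eqxx.
have := npoints0P h0 (i := 0) isT; rewrite /cycle_length3.
have -> : nth 0 (x :: rcons s z) 0 = x by [].
rewrite hlast hx /= -!hx; case: (z =P 0) => [z0 _|/eqP z0].
  left; apply: dec_revw => //.
  move: hav; rewrite z0 -rcons_cons av231_rcons => /andP[_].
  have hpos : all (ltn 0) (x :: s).
    apply/allP => v hv /=; rewrite lt0n; apply/eqP => v0.
    have := isperm_uniq hw; rewrite -rcons_cons rcons_uniq z0.
    by rewrite -[X in X \notin _]v0 hv.
  rewrite (all_filterP hpos)  -cats1 pairwise_cat allrel1r => -> /=.
  by rewrite andbT; apply/allP.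
case: ifP => // /eqP hz _; right.
case: z => // p in hw hav h0 hlast z0 hz *.
rewrite hx in hw hz hlast *.
(* In a word of two letters the nonzero last letter would be 1, repeating the first. *)
case hs : (size s) => [|m] in hw hz hlast *.
  move: (isperm_lt hw (v := p.+1)); rewrite /= size_rcons hs => h.
  have {h} : p.+1 < 2 by apply: h; rewrite !inE mem_rcons inE eqxx orbT.
  case: p hw {hz hlast hav h0 z0} => // /isperm_uniq /=.
  by rewrite (size0nil hs).
by have [w [h1 h2 h3]] := extP hw hs hz; exists w, p.
Qed.

(** The word is cut before its maximum. If the left part is empty, [w] is a block and the gap is
    compared with the gap of that block; otherwise the gap must be the place of the cut, and both
    parts decrease. *)
Lemma pair_cases w p : isperm w -> av231 w -> npoints 0 w = 0 -> p <= size w ->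
    pair_cond w p ->
  [\/ w = revw (size w),
      exists a b, [/\ 0 < a, 0 < b, w = dsum (revw a) (revw b) & p = a] |
      exists u q, [/\ isperm u, q <= size u, w = ext u q & p = q.+1 \/ p = q.+2]].
Proof.
move=> hw hav h0 hp hpc.
have [->|wN0] := eqVneq w [::]; first exact: Or31.
have [u [v [e hu hv vN0 hd]]] := isperm_max_decomp hw hav wN0.
have [u0|uN0] := eqVneq u [::].
  have {u0} e' : w = v.
    by rewrite e u0 /dsum /= map_id_in.
  rewrite -e' in hv vN0 hd.
  have [|[u' [q [h1 h2 h3]]]] := block_cases hw hav h0 vN0 hd; first exact: Or31.
  apply: Or33; exists u', q; split=> //.
  have [h|h|] := ltngtP p q.+2; [|exfalso|by right].
    (* If p <= q, the value q and the final letter q+1 are both at least p and appear in increasing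
       order. *)
    left; apply/eqP; rewrite eqn_leq -ltnS h /= ltnNge; apply/negP => hpq.
    have : q \in w by rewrite isperm_mem // h3 size_ext //; lia.
    move: hpc => /andP[_]; rewrite h3 /ext -rcons_cons -rcons_cat -rcons_cons.
    set s := _ :: _; rewrite filter_rcons leqW // -cats1 pairwise_cat allrel1r.
    move=> /andP[/allP hall _]; rewrite mem_rcons inE => /orP[/eqP|]; first by lia.
    by move=> hq; have := hall q; rewrite mem_filter hpq hq /= => /(_ isT); rewrite ltnn.
  (* If p >= q+3, the letter 0 at position q+1 and the positive letter after it both lie among the
     first p entries, an ascent. *)
  move: hpc => /andP[]; rewrite h3 /ext.
  set s := map _ _; have hs : size s = q by rewrite size_map size_takel.
  have [r hr] : exists r, p = q.+1 + r.+2 by exists (p - q.+3); lia.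
  rewrite -cat_cons take_cat /= hs ltnNge hr leq_addr /= addKn pairwise_cat /=.
  case es : (rcons _ _) => [|y t] /=; first by move/(congr1 size): es; rewrite size_rcons.
  move=> /and4P[_ _ _ /andP[/andP[hy _] _]] _.
  have : y \in rcons [seq skip q i | i <- drop q u'] q.+1 by rewrite es inE eqxx.
  rewrite mem_rcons inE => /predU1P[yq|/mapP[i _ yq]]; first by rewrite yq in hy.
  by have := skip_gt0 q i; rewrite -yq; move: hy; rewrite /geq /=; lia.
have su : 0 < size u by rewrite lt0n size_eq0.
have sv : 0 < size v by rewrite lt0n size_eq0.
have hlt := allrel_ltn_shift v hu.
move: hpc; rewrite e /pair_cond /dsum => /andP[hd1 hd2].
have [hpu|hpu|hpu] := ltngtP p (size u).
(* A gap inside [u] leaves the maximum of [u] and, later, the maximum of [v] among the values at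
   least [p], an ascent. *)
- exfalso; move: hd2; rewrite filter_cat pairwise_cat => /andP[/allrelP h _].
  have := h (size u).-1 (size u + head 0 v).
  rewrite !mem_filter isperm_mem // prednK // leqnn map_f; last first.
    by case: (v) vN0 => // a v' _; rewrite inE eqxx.
  have -> : p <= (size u).-1 by lia.
  have -> : p <= size u + head 0 v by lia.
  by move=> /(_ isT isT) /=; lia.
(* A gap beyond [u] puts the first letters of both parts among the first [p] entries, an ascent. *)
- exfalso; move: hd1; rewrite take_cat ltnNge ltnW //= pairwise_cat => /andP[/allrelP h _].
  have := h (head 0 u) (size u + head 0 v).
  have -> : head 0 u \in u by case: (u) uN0 => // a u' _; rewrite inE eqxx.
  have -> : size u + head 0 v \in take (p - size u) [seq size u + i | i <- v].
    rewrite -map_take map_f //; case: (v) vN0 => // a v' _.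
    by rewrite -[p - _]prednK ?inE ?eqxx //; lia.
  have : head 0 u < size u by apply: isperm_lt => //; case: (u) uN0 => // a u' _; rewrite inE eqxx.
  by move=> ? /(_ isT isT) /=; lia.
apply: Or32; exists (size u), (size v); split=> //.
rewrite -(dec_revw hu); last by move: hd1; rewrite hpu take_size_cat.
rewrite -(dec_revw hv) //; move: hd2; rewrite filter_cat pairwise_cat => /and3P[_ _].
have /all_filterP -> : all (leq p) [seq size u + i | i <- v].
  by apply/allP => _ /mapP[i _ ->]; lia.
by rewrite pairwise_geq_map // => x y; rewrite ltn_add2l.
Qed.

Lemma pair_cond_revw m p : pair_cond (revw m) p.
Proof.
rewrite /pair_cond; have h := revw_dec m; apply/andP; split.
  by move: h; rewrite -{1}(cat_take_drop p (revw m)) pairwise_cat => /and3P[].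
exact: (subseq_pairwise (filter_subseq _ _) h).
Qed.

Lemma pair_cond_dsum a b : pair_cond (dsum (revw a) (revw b)) a.
Proof.
rewrite /pair_cond /dsum take_size_cat ?size_revw // revw_dec filter_cat.
rewrite (_ : [seq v <- revw a | a <= v] = [::]); last first.
  apply/eqP; rewrite -[_ == _]negbK -has_filter; apply/negP => /hasP[v].
  by move=> /(isperm_lt (revw_isperm a)); rewrite size_revw; lia.
apply: (subseq_pairwise (filter_subseq _ _)).
by rewrite pairwise_geq_map ?revw_dec // => x y; rewrite ltn_add2l.
Qed.

(** Converse of the last case of [pair_cases], with [r] covering both gaps. The prefix is the
    maximum followed by the first [p] letters of [w], and also the 0 when r = 1; the large values
    are the maximum, those of [w] from [p] on, and also the final p+1 when r = 0. *)
Lemma pair_cond_ext w p r : isperm w -> p <= size w -> pair_cond w p ->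
  r < 2 -> pair_cond (ext w p) (p.+1 + r).
Proof.
move=> hw hp /andP[h1 h2] hr.
have hmax s : {subset s <= w} -> all (geq (size w).+2) (map (skip p) s).
  by move=> hs; apply/allP => _ /mapP[v /hs /(isperm_lt hw) hv ->] /=; rewrite /skip; case: ifP; lia.
have hA : pairwise geq ((size w).+2 :: map (skip p) (take p w)).
  rewrite /= pairwise_geq_map ?h1 ?andbT ?hmax //; first by move=> v /mem_take.
  exact: skip_mono.
have hB : pairwise geq ((size w).+2 :: map (skip p) [seq v <- w | p <= v]).
  rewrite /= pairwise_geq_map ?h2 ?andbT ?hmax //; first by move=> v; rewrite mem_filter => /andP[].
  exact: skip_mono.
have sA : size ((size w).+2 :: map (skip p) (take p w)) = p.+1.
  by rewrite /= size_map size_takel.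
apply/andP; split.
  rewrite /ext -cat_cons take_cat sA ltnNge leq_addr addKn pairwise_cat hA.
  case: r hr => [|[|]] // _; rewrite ?take0 ?allrel0r //=.
  by rewrite take0 allrel1r; apply/andP; split=> //; apply/allP.
rewrite /ext /= filter_cat /= filter_rcons.
have -> : p.+1 + r <= (size w).+2 by lia.
have hf s : [seq v <- map (skip p) s | p.+1 + r <= v] = map (skip p) [seq v <- s | p <= v].
  rewrite filter_map; congr map; apply: eq_filter => v /=; rewrite /skip; case: ifP; lia.
rewrite !hf.
rewrite (_ : _ ++ _ = map (skip p) [seq v <- w | p <= v] ++ if r == 0 then [:: p.+1] else [::]).
  rewrite -cat_cons pairwise_cat hB.
  case: r {hf} hr => [|[|]] // _; rewrite ?allrel0r //= allrel1r /= andbT.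
  apply/andP; split; first by lia.
  by rewrite all_map; apply/allP => v; rewrite mem_filter /skip /= => /andP[? _]; case: ifP; lia.
rewrite -[in RHS](cat_take_drop p w) filter_cat map_cat -catA; congr cat.
by case: r {hf} hr => [|[|]] // _; rewrite ?addn0 ?leqnn ?addn1 ?ltnn ?cats0 ?cats1.
Qed.

Lemma last_ext w p : last 0 (ext w p) = p.+1.
Proof. by rewrite /ext /= last_cat /= last_rcons. Qed.

Lemma last_revw n : last 0 (revw n) = 0.
Proof. by case: n => // n; rewrite /revw /= rev_cons last_rcons. Qed.

Lemma head_revw n : head 0 (revw n) = n.-1.
Proof. by case: n => // n; rewrite -nth0 nth_revw // subn1. Qed.

Lemma ext_inj w p w' p' : p <= size w -> p' <= size w' -> ext w p = ext w' p' ->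
  w = w' /\ p = p'.
Proof.
move=> hp hp' e.
have [es] : (size w).+3 = (size w').+3 by rewrite -(size_ext hp) -(size_ext hp') e.
have [ep] : p.+1 = p'.+1 by rewrite -(last_ext w) -(last_ext w') e.
subst p'; split=> //; move/eqP: e; rewrite /ext eqseq_cons => /andP[_].
rewrite eqseq_cat ?size_map ?size_takel // eqseq_cons eqseq_rcons !eqxx andbT /=.
move=> /andP[/eqP/(inj_map (@skip_inj p)) e1 /eqP/(inj_map (@skip_inj p)) e2].
by rewrite -(cat_take_drop p w) e1 e2 cat_take_drop.
Qed.

(** * Enumeration of good words, pairs and blocks *)

Definition good_words (n : nat) : seq (seq nat) :=
  [seq w <- permutations (iota 0 n) | av231 w && (npoints 0 w == 0)].

Lemma good_wordsP n w : reflect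
  [/\ isperm w, size w = n, av231 w & npoints 0 w = 0] (w \in good_words n).
Proof.
rewrite mem_filter mem_permutations; apply: (iffP andP).
  move=> [/andP[h1 /eqP h2] h3]; have hs : size w = n by rewrite (perm_size h3) size_iota.
  by split=> //; rewrite /isperm hs.
by move=> [h1 h2 h3 h4]; rewrite h3 h4 -h2.
Qed.

Lemma good_words_uniq n : uniq (good_words n).
Proof. exact/filter_uniq/permutations_uniq. Qed.

(** These are the pairs whose extension by a 3-cycle is again a good word. *)
Definition good_pairs (m : nat) : seq (seq nat * nat) :=
  [seq x <- [seq (w, p) | w <- good_words m, p <- iota 0 m.+1] | pair_cond x.1 x.2].

Lemma good_pairsP m w p : reflect
  [/\ w \in good_words m, p <= m & pair_cond w p] ((w, p) \in good_pairs m).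
Proof.
rewrite [(w, p) \in _]mem_filter; apply: (iffP andP).
  move=> [hc /allpairsP[[w' p'] [hw hp [ew ep]]]]; move: hp; rewrite mem_iota ew ep add0n ltnS /= => hp.
  by split=> //; rewrite -ew -ep.
move=> [hw hp hc]; split=> //; apply/allpairsP; exists (w, p); split=> //.
by rewrite mem_iota.
Qed.

Lemma good_pairs_uniq m : uniq (good_pairs m).
Proof.
apply: filter_uniq; apply: allpairs_uniq; rewrite ?good_words_uniq ?iota_uniq //.
by move=> [? ?] [? ?] _ _.
Qed.

Definition ext_pair (x : seq nat * nat) : seq nat := ext x.1 x.2.

Lemma good_pairs_ext m x : x \in good_pairs m -> ext_pair x \in good_words m.+3.
Proof.
case: x => w p /good_pairsP[/good_wordsP[h1 h2 h3 h4] h5 h6].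
rewrite -h2 in h5; apply/good_wordsP; rewrite -[ext_pair _]/(ext w p); split.
- exact: ext_isperm.
- by rewrite size_ext // h2.
- by rewrite ext_av231 // h3.
- by rewrite ext_npoints // h4.
Qed.

Lemma good_pairs_ext_inj m m' : {in good_pairs m & good_pairs m',
  forall x y, ext_pair x = ext_pair y -> x = y}.
Proof.
move=> [w p] [w' p'] /good_pairsP[/good_wordsP[_ h2 _ _] h5 _].
move=> /good_pairsP[/good_wordsP[_ h2' _ _] h5' _] e.
by case: (@ext_inj w p w' p'); rewrite ?h2 ?h2' // => -> ->.
Qed.

Lemma ext_good_word n u p : isperm u -> p <= size u -> ext u p \in good_words n ->
  n = (size u).+3 /\ (u, p) \in good_pairs (size u).
Proof.
move=> hu hp /good_wordsP[_ h2 h3 h4]; rewrite size_ext // in h2; split=> //.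
rewrite ext_av231 // in h3; rewrite ext_npoints // addn0 in h4.
by have [h3' h3''] := andP h3; apply/good_pairsP; split=> //; apply/good_wordsP.
Qed.

Lemma revw_good n : revw n \in good_words n.
Proof. by apply/good_wordsP; rewrite revw_isperm size_revw revw_av231 revw_npoints0. Qed.

Lemma dsum_good a b u v : u \in good_words a -> v \in good_words b ->
  dsum u v \in good_words (a + b).
Proof.
move=> /good_wordsP[h1 h2 h3 h4] /good_wordsP[g1 g2 g3 g4]; apply/good_wordsP; split.
- exact: dsum_isperm.
- by rewrite size_dsum h2 g2.
- by rewrite dsum_av231 // h3.
- by rewrite dsum_npoints // h4 g4.
Qed.

Definition blocks (n : nat) : seq (seq nat) :=
  (if n is 0 then [::] else [:: revw n])
  ++ (if n is m.+3 then map ext_pair (good_pairs m) else [::]).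

Lemma blocksP n w : reflect
  [/\ w \in good_words n, 0 < n & head 0 w = n.-1] (w \in blocks n).
Proof.
rewrite /blocks mem_cat; apply: (iffP orP) => [[]|[hw n0 hd]].
- case: n => // n; rewrite inE => /eqP ->; split=> //; last by rewrite head_revw.
  exact: revw_good.
- case: n => [|[|[|m]]] // /mapP[x hx ->]; split=> //; first exact: good_pairs_ext.
  by case: x hx => u p /good_pairsP[/good_wordsP[_ <- _ _]].
have /good_wordsP[h1 h2 h3 h4] := hw.
have wN0 : w != [::] by rewrite -size_eq0 h2 -lt0n.
have hd' : head 0 w = (size w).-1 by rewrite h2.
case: (block_cases h1 h3 h4 wN0 hd') => [e|[u [p [hu hp e]]]].
  by left; rewrite e h2; case: (n) n0 => // k _; rewrite inE.
right; rewrite e in hw.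
have [-> hpair] := ext_good_word hu hp hw.
by rewrite e; apply/mapP; exists (u, p).
Qed.

(** The two kinds of block differ in the last letter: 0 for a decreasing word, p+1 for an
    extension. *)
Lemma blocks_uniq n : uniq (blocks n).
Proof.
rewrite /blocks; case: n => [|[|[|m]]] //; rewrite cat_uniq /=; apply/andP; split.
  rewrite -all_predC; apply/allP => _ /mapP[[w p] _ ->] /=; rewrite inE.
  by apply/eqP => /(congr1 (last 0)); rewrite last_ext last_revw.
by rewrite map_inj_in_uniq ?good_pairs_uniq //; apply: good_pairs_ext_inj.
Qed.

Definition dsum_conv (L M : nat -> seq (seq nat)) (n : nat) : seq (seq nat) :=
  [seq dsum x.1 x.2 | k <- iota 0 n.+1, x <- [seq (u, v) | u <- L k, v <- M (n - k)]].

Lemma dsum_convP L M n w : reflect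
  (exists k u v, [/\ k <= n, u \in L k, v \in M (n - k) & w = dsum u v]) (w \in dsum_conv L M n).
Proof.
apply: (iffP allpairsPdep) => [[k [x [hk /allpairsP[[u v] [hu hv ->]] ->]]]|].
  by exists k, u, v; split=> //; move: hk; rewrite mem_iota.
move=> [k [u [v [hk hu hv ->]]]]; exists k, (u, v); rewrite mem_iota; split=> //.
by apply/allpairsP; exists (u, v).
Qed.

(** The second summand starts with the maximum of the whole word, so the position of that maximum
    recovers the cut. *)
Lemma block_sum_inj a b a' b' u v u' v' :
    u \in good_words a -> v \in blocks b -> u' \in good_words a' -> v' \in blocks b' ->
  dsum u v = dsum u' v' -> u = u' /\ v = v'.
Proof.
have hidx c d s t : s \in good_words c -> t \in blocks d ->
    index (size (dsum s t)).-1 (dsum s t) = c.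
  move=> /good_wordsP[h1 h2 _ _] /blocksP[/good_wordsP[g1 g2 _ _] g3 g4].
  rewrite size_dsum index_cat isperm_mem // h2 g2 ltnNge.
  have -> /= : c <= (c + d).-1 by lia.
  case: t g1 g2 g4 => [|y t] //= _ g2 ->; first by lia.
  by rewrite (_ : c + d.-1 = (c + d).-1) ?eqxx ?addn0 //; lia.
move=> hu hv hu' hv' e; have ha : a = a' by rewrite -(hidx _ _ _ _ hu hv) e (hidx _ _ _ _ hu' hv').
have /good_wordsP[_ su _ _] := hu; have /good_wordsP[_ su' _ _] := hu'.
move/eqP: e; rewrite /dsum eqseq_cat ?su ?su' // ha.
by move=> /andP[/eqP -> /eqP /(inj_map (@addnI a')) ->].
Qed.

(** Combinatorial form of B = 1 + B J: a nonempty good word is cut uniquely before its maximum. *)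
Lemma good_words_perm n : perm_eq (good_words n)
  ((if n is 0 then [:: [::]] else [::]) ++ dsum_conv good_words blocks n).
Proof.
apply: uniq_perm; first exact: good_words_uniq.
  case: n => [|n]; first by [].
  apply: allpairs_uniq_dep; first exact: iota_uniq.
    move=> k _; apply: allpairs_uniq; rewrite ?good_words_uniq ?blocks_uniq //.
    by move=> [? ?] [? ?] _ _.
  (* Uniqueness of the dependent product requires injectivity on triples (k, (u, v)); the index [k]
     is recovered as the size of [u]. *)
  pose T := {_ : nat & (seq nat * seq nat)%type}.
  have hst (x : T) : x \in [seq existT (fun _ : nat => (seq nat * seq nat)%type) k y : T | k <- iota 0 n.+2,
       y <- [seq (u, v) | u <- good_words k, v <- blocks (n.+1 - k)]] ->
      (projT2 x).1 \in good_words (projT1 x) /\ (projT2 x).2 \in blocks (n.+1 - projT1 x).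
    move=> /allpairsPdep[k [y [_ /allpairsP[[u v] [hu hv ->]] ->]]]. by split.
  move=> [k [u v]] [k' [u' v']] /hst[hu hv] /hst[hu' hv'] e.
  have [eu ev] := block_sum_inj hu hv hu' hv' e.
  rewrite /= in eu ev hu hu'; rewrite eu ev.
  by have -> : k = k' by move: hu hu'; rewrite eu => /good_wordsP[_ <- _ _] /good_wordsP[_ <- _ _].
move=> w; rewrite mem_cat; apply/idP/orP => [hw|[]].
- have /good_wordsP[h1 h2 h3 h4] := hw.
  have [w0|wN0] := eqVneq w [::]; first by left; move: h2; rewrite w0 => <-.
  right; have [u [v [e hu hv vN0 hd]]] := isperm_max_decomp h1 h3 wN0.
  rewrite e dsum_av231 // in h3; rewrite e dsum_npoints // in h4.
  have hn : n = size u + size v by rewrite -h2 e size_dsum.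
  have [h3u h3v] := andP h3.
  apply/dsum_convP; exists (size u), u, v; split=> //; first by lia.
    by apply/good_wordsP; split=> //; lia.
  rewrite hn addKn; apply/blocksP; split=> //; last by rewrite lt0n size_eq0.
  by apply/good_wordsP; split=> //; lia.
- by case: n => // ; rewrite inE => /eqP ->.
- move=> /dsum_convP[k [u [v [hk hu /blocksP[hv _ _] ->]]]].
  by rewrite -(subnKC hk); apply: dsum_good.
Qed.

(** Combinatorial form of D = M + (R-1)^2 + 2 y D, the two copies of D coming from the gaps q+1 and
    q+2. *)
Lemma good_pairs_perm m : perm_eq (good_pairs m)
  ([seq (revw m, p) | p <- iota 0 m.+1]
   ++ [seq (dsum (revw a) (revw (m - a)), a) | a <- iota 1 m.-1]
   ++ (if m is k.+3 then [seq (ext_pair x, x.2.+1) | x <- good_pairs k]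
                          ++ [seq (ext_pair x, x.2.+2) | x <- good_pairs k]
       else [::])).
Proof.
set s1 := map _ _; set s2 := map _ _; set s3 := (X in _ ++ _ ++ X).
(* The families are disjoint because of the end letters: words of [s2] do not start with their
   maximum, while words of [s3] do but, unlike decreasing ones, do not end in 0. *)
have h1 x : x \in s1 -> x.1 = revw m by case/mapP => p _ ->.
have h2 x : x \in s2 -> head 0 x.1 != m.-1.
  case/mapP => a; rewrite mem_iota => ha ->; rewrite /dsum.
  have : head 0 (revw a) = a.-1 by rewrite head_revw.
  have : size (revw a) = a by rewrite size_revw.
  by case: (revw a) => /=; lia.
have h3 x : x \in s3 -> head 0 x.1 = m.-1 /\ last 0 x.1 != 0.
  rewrite /s3; case: (m) => [|[|[|k]]] //; rewrite mem_cat => /orP[] /mapP[[w p] hx ->];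
  have /good_pairsP[/good_wordsP[_ sw _ _] _ _] := hx;
  by split; [rewrite /= sw | rewrite -[X in last 0 X]/(ext w p) last_ext].
apply: uniq_perm; first exact: good_pairs_uniq.
  rewrite !cat_uniq has_cat negb_or -andbA; apply/and5P; split.
  - by rewrite map_inj_uniq ?iota_uniq // => p q [].
  - apply/hasPn => x hx; apply: contra (h2 _ hx) => /h1 ->; by rewrite head_revw.
  - by apply/hasPn => x /h3[_ hx]; apply: contra hx => /h1 ->; rewrite last_revw.
  - by rewrite map_inj_uniq ?iota_uniq // => p q [].
  apply/andP; split.
    by apply/hasPn => x /h3[hx _]; apply/negP => /h2; rewrite hx eqxx.
  rewrite /s3; case: (m) => [|[|[|k]]] //.
  have hinj : {in good_pairs k &, injective ext_pair} by apply: good_pairs_ext_inj.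
  rewrite cat_uniq !map_inj_in_uniq ?good_pairs_uniq ?andbT /=.
  (* Equal words have equal last letters, hence p = p', which contradicts the equality of the gaps
     p+2 and p'+1. *)
  - apply/hasPn => _ /mapP[[w p] _ ->]; apply/mapP => -[[w' p'] _ e].
    have e1 : last 0 (ext w p) = last 0 (ext w' p') := congr1 (fun x => last 0 x.1) e.
    have e2 : p.+2 = p'.+1 := congr1 snd e.
    by rewrite !last_ext in e1; lia.
  - by move=> x y hx hy e; apply: hinj => //; apply: (congr1 fst e).
  - by move=> x y hx hy e; apply: hinj => //; apply: (congr1 fst e).
move=> [w p]; rewrite !mem_cat; apply/good_pairsP/or3P.
  move=> [hw hp hc]; have /good_wordsP[g1 g2 g3 g4] := hw.
  rewrite -g2 in hp; case: (pair_cases g1 g3 g4 hp hc) => [e|[a [b [ha hb e ->]]]|[u [q [hu hq e hpq]]]].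
  - apply: Or31; apply/mapP; exists p; first by rewrite mem_iota ltnS -g2.
    by rewrite -g2 -e.
  - have em : m = a + b by rewrite -g2 e size_dsum !size_revw.
    apply: Or32; apply/mapP; exists a; last by rewrite em addKn -e.
    by rewrite mem_iota; lia.
  apply: Or33; rewrite e in hw; have [em hx] := ext_good_word hu hq hw.
  rewrite /s3 em mem_cat; apply/orP.
  by case: hpq => ->; [left | right]; apply/mapP; exists (u, q); rewrite // e.
case=> [/mapP[q]|/mapP[a]|].
- rewrite mem_iota => hq [-> ->]; split; first exact: revw_good.
    by move: hq; rewrite add0n ltnS.
  exact: pair_cond_revw.
- have hlt b : 1 <= b < 1 + m.-1 -> b <= m by lia.
  rewrite mem_iota => /hlt ha [-> ->]; split=> //; last exact: pair_cond_dsum.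
  by rewrite -{2}(subnKC ha); apply: dsum_good; apply: revw_good.
rewrite /s3; case: (m) => [|[|[|k]]] //.
rewrite mem_cat => /orP[] /mapP[[u q] hx [-> ->]]; (split; first exact: good_pairs_ext);
  have /good_pairsP[/good_wordsP[g1 g2 _ _] g5 g6] := hx; try (by lia); rewrite -g2 in g5.
- by rewrite -[q.+1]addn0; apply: pair_cond_ext.
- by rewrite -[q.+2]addn1; apply: pair_cond_ext.
Qed.

(** * Permutations as words *)

Lemma av231P w : reflect
  (forall i j k, i < j -> j < k -> k < size w ->
     ~~ ((nth 0 w k < nth 0 w i) && (nth 0 w i < nth 0 w j))) (av231 w).
Proof.
elim: w => [|x s IH] /=; first by apply: ReflectT.
apply: (iffP andP) => [[/(pairwiseP 0) h1 /IH h2] [|i] [|j] [|k] //= hij hjk hk|h].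
- exact: (h1 j k (ltn_trans hjk hk) hk hjk).
- exact: h2.
split; last by apply/IH => i j k hij hjk hk; apply: (h i.+1 j.+1 k.+1).
apply/(pairwiseP 0) => j k _ hk hjk; exact: (h 0 j.+1 k.+1).
Qed.

Definition word n (s : 'S_n) : seq nat := [seq val (s i) | i <- enum 'I_n].

Lemma size_word n (s : 'S_n) : size (word s) = n.
Proof. by rewrite size_map size_enum_ord. Qed.

Lemma nth_word n (s : 'S_n) (i : 'I_n) : nth 0 (word s) i = s i.
Proof. by rewrite (nth_map i) ?size_enum_ord // nth_ord_enum. Qed.

Lemma word_inj n : injective (@word n).
Proof.
move=> s s' e; apply/permP => i; apply: val_inj.
by rewrite /= -!nth_word e.
Qed.

Lemma word_isperm n (s : 'S_n) : isperm (word s).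
Proof.
apply: isperm_intro.
  rewrite map_inj_uniq ?enum_uniq // => i j /val_inj; exact: perm_inj.
by move=> _ /mapP[i _ ->]; rewrite size_word; apply: ltn_ord.
Qed.

Lemma word_surj n w : isperm w -> size w = n -> exists s : 'S_n, word s = w.
Proof.
move=> hw hs.
have hlt (i : 'I_n) : nth 0 w i < n by rewrite -[X in _ < X]hs isperm_nth // hs.
have hinj : injective (fun i : 'I_n => Ordinal (hlt i)).
  move=> i j [] /eqP; rewrite nth_uniq ?hs ?isperm_uniq //.
  by move/eqP/val_inj.
exists (perm hinj); apply: (@eq_from_nth _ 0); rewrite size_word // => i hi.
by rewrite -[i]/(val (Ordinal hi)) nth_word permE.
Qed.

Lemma av231_word n (s : 'S_n) : av231 (word s) = avoids231 s.
Proof.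
rewrite /avoids231 /contains231; apply/av231P/existsPn => [h i|h i j k].
  apply/existsPn => j; apply/existsPn => k.
  have := h i j k; rewrite size_word !nth_word.
  by case: (ltnP i j) => //= _; case: (ltnP j k) => //= _ /(_ isT isT (ltn_ord k)).
rewrite size_word => hij hjk hk; have hj := ltn_trans hjk hk; have hi := ltn_trans hij hj.
have /existsPn/(_ (Ordinal hj))/existsPn/(_ (Ordinal hk)) := h (Ordinal hi).
rewrite /= hij hjk /= -!nth_word.
by [].
Qed.

(** The trajectory of [i], taken for as many steps as its orbit has elements, has no repetition and
    then returns to [i]; the first return is therefore the orbit size. *)
Lemma cycle_length3_word n (s : 'S_n) (i : 'I_n) :
  cycle_length3 (nth 0 (word s)) i = if #|porbit s i| <= 3 then #|porbit s i| else 0.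
Proof.
rewrite /cycle_length3 !nth_word !(inj_eq val_inj).
have := uniq_traject_porbit s i; have := iter_porbit s i.
have : 0 < #|porbit s i| by apply/card_gt0P; exists i; apply: porbit_id.
case: #|porbit s i| => [|[|[|[|k]]]] //= _.
- by move=> ->; rewrite eqxx.
- by move=> ->; rewrite inE andbT eq_sym eqxx => /negbTE ->.
- move=> ->; rewrite !inE negb_or eqxx ![_ == i]eq_sym.
  by move=> /andP[/andP[/negbTE -> /negbTE ->] _].
- move=> _; rewrite !inE !negb_or ![_ == i]eq_sym.
  by move=> /andP[/and4P[/negbTE -> /negbTE -> /negbTE -> _] _].
Qed.

Lemma npoints_word k n (s : 'S_n) :
  npoints k (word s) = #|[set i : 'I_n | cycle_length3 (nth 0 (word s)) i == k]|.
Proof.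
rewrite /npoints size_word -val_enum_ord count_map enumT cardsE cardE /enum_mem size_filter.
by apply: eq_count => i.
Qed.

(** The k-cycles partition the points counted on the left into parts of size k. *)
Lemma npoints_ncycles k n (s : 'S_n) : 0 < k <= 3 -> npoints k (word s) = k * ncycles k s.
Proof.
move=> hk; rewrite npoints_word mulnC.
apply: card_uniform_partition; first by move=> C; rewrite inE => /andP[_ /eqP].
have hi (i : 'I_n) : (cycle_length3 (nth 0 (word s)) i == k) = (#|porbit s i| == k).
  by rewrite cycle_length3_word; case: ifP => //; lia.
apply/and3P; split.
- apply/eqP/setP => i; rewrite inE hi; apply/bigcupP/idP => [[C]|h].
    by rewrite inE => /andP[/imsetP[j _ ->] hC]; rewrite -eq_porbit_mem => /eqP ->.
  by exists (porbit s i); rewrite ?porbit_id // inE h imset_f.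
- apply/trivIsetP => A C; rewrite !inE => /andP[/imsetP[i _ ->] _] /andP[/imsetP[j _ ->] _].
  apply: contraR => /pred0Pn[x /=]; rewrite -!eq_porbit_mem => /andP[/eqP <- /eqP <-].
  by [].
- by rewrite inE cards0; apply/negP => /andP[_ /eqP]; lia.
Qed.

Lemma npoints0_word n (s : 'S_n) : (npoints 0 (word s) == 0) = cycles_le3 s.
Proof.
have hc (i : 'I_n) : 0 < #|porbit s i| by apply/card_gt0P; exists i; apply: porbit_id.
rewrite npoints_word cards_eq0; apply/eqP/forallP => [h C|h].
  apply/implyP => /imsetP[i _ ->]; rewrite hc /=.
  by move/setP/(_ i): h; rewrite !inE cycle_length3_word; case: ifP.
apply/setP => i; rewrite !inE cycle_length3_word.
have := h (porbit s i); rewrite imset_f //= => /andP[h1 h2].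
by rewrite h2 eqn0Ngt h1.
Qed.


(** The factors 2 and 3 appear because [npoints] counts points and not cycles. *)
Definition has_cycle_type (a b c : nat) (w : seq nat) : bool :=
  [&& npoints 1 w == a, npoints 2 w == 2 * b & npoints 3 w == 3 * c].

Lemma Bcoef_count a b c :
  Bcoef a b c = count (has_cycle_type a b c) (good_words (a + 2 * b + 3 * c)).
Proof.
rewrite /Bcoef -size_filter cardE -(size_map (@word _)); apply/perm_size/uniq_perm.
- by rewrite (map_inj_uniq (@word_inj _)) enum_uniq.
- exact/filter_uniq/good_words_uniq.
set n := a + _ + _.
have hs (s : 'S_n) : has_cycle_type a b c (word s) = [&& ncycles 1 s == a, ncycles 2 s == b & ncycles 3 s == c].
  by rewrite /has_cycle_type !npoints_ncycles // mul1n !eqn_pmul2l.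
move=> w; rewrite mem_filter; apply/mapP/andP => [[s]|].
  rewrite mem_enum inE => /andP[/andP[h1 h2] h3] ->; rewrite hs; split=> //.
  apply/good_wordsP; split.
  - exact: word_isperm.
  - by rewrite size_word.
  - by rewrite av231_word.
  - by apply/eqP; rewrite npoints0_word.
move=> [h1 /good_wordsP[g1 g2 g3 g4]]; have [s e] := word_surj g1 g2.
exists s => //; rewrite mem_enum inE -hs e h1 andbT /in_S3_231.
by rewrite -av231_word -npoints0_word e g3 g4.
Qed.

(** * The ring of formal power series *)

Lemma ps_ext (F G : ps) : (forall a b c, F a b c = G a b c) -> F = G.
Proof. by move=> h; do 3! (apply: functional_extensionality => ?); apply: h. Qed.

Definition ps_opp (F : ps) : ps := fun a b c => (- F a b c)%R.

Lemma sum_ord_rev (V : nmodType) (f : nat -> nat -> V) n :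
  (\sum_(i < n.+1) f i (n - i)%N = \sum_(i < n.+1) f (n - i)%N i)%R.
Proof.
rewrite (reindex_inj rev_ord_inj) /=; apply: eq_bigr => i _.
by rewrite subSS subKn // -ltnS.
Qed.

(** Both sides run over the triples of naturals with sum [n]; the induction splits off those with
    first entry 0. It is the one-variable core of associativity. *)
Lemma sum_triangle (V : nmodType) (f : nat -> nat -> nat -> V) n :
  (\sum_(i < n.+1) \sum_(j < i.+1) f j (i - j)%N (n - i)%N =
   \sum_(i < n.+1) \sum_(j < (n - i).+1) f i j (n - i - j)%N)%R.
Proof.
elim: n f => [|n IH] f; first by rewrite !big_ord1.
rewrite [RHS]big_ord_recl [X in (_ + X)%R](eq_bigr (fun i : 'I_n.+1 =>
  \sum_(j < (n - i).+1) f i.+1 j (n - i - j)%N)%R); last first.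
  by move=> i _; rewrite /= subSS.
rewrite -(IH (fun i => f i.+1)).
rewrite (eq_bigr (fun i : 'I_n.+2 => f 0 i (n.+1 - i)%N + \sum_(j < i) f j.+1 (i - j.+1)%N (n.+1 - i)%N)%R).
  rewrite big_split /= subn0; congr (_ + _)%R.
  by rewrite big_ord_recl big_ord0 add0r; apply: eq_bigr => i _.
by move=> i _; rewrite big_ord_recl subn0.
Qed.

Lemma sum_ord_delta (n p : nat) (g : nat -> int) :
  (\sum_(i < n.+1) (if i == p :> nat then g i else 0) = if (p <= n)%N then g p else 0)%R.
Proof. by rewrite -big_mkcond big_ord1_eq ltnS. Qed.

(** The monomial r t^p x^q y^s; the variables and the constant 1 are instances up to conversion. *)
Definition ps_mon (r : int) (p q s : nat) : ps :=
  fun a b c => if [&& a == p, b == q & c == s] then r else 0%R.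

Lemma ps_monM r p q s F a b c : ps_mul (ps_mon r p q s) F a b c =
  (if [&& (p <= a)%N, (q <= b)%N & (s <= c)%N] then r * F (a - p)%N (b - q)%N (c - s)%N else 0)%R.
Proof.
rewrite /ps_mul.
transitivity (\sum_(i < a.+1) (if i == p :> nat then
  \sum_(j < b.+1) (if j == q :> nat then
   \sum_(k < c.+1) (if k == s :> nat then r * F (a - i)%N (b - j)%N (c - k)%N else 0) else 0) else 0))%R.
  apply: eq_bigr => i _; case: eqP => hi; last first.
    by apply: big1 => j _; apply: big1 => k _; rewrite /ps_mon; case: eqP => // _; rewrite mul0r.
  apply: eq_bigr => j _; case: eqP => hj; last first.
    apply: big1 => k _; rewrite /ps_mon (_ : (_ == q) = false) ?andbF ?mul0r //.
    exact/eqP.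
  apply: eq_bigr => k _; rewrite /ps_mon hi hj !eqxx /=.
  by case: eqP => _; rewrite ?mul0r.
rewrite (sum_ord_delta _ _ (fun i => \sum_(j < b.+1) (if j == q :> nat then
   \sum_(k < c.+1) (if k == s :> nat then r * F (a - i)%N (b - j)%N (c - k)%N else 0) else 0))%R).
case: leqP => //= _.
rewrite (sum_ord_delta _ _ (fun j =>
   \sum_(k < c.+1) (if k == s :> nat then r * F (a - p)%N (b - j)%N (c - k)%N else 0))%R).
case: leqP => //= _.
by rewrite (sum_ord_delta _ _ (fun k => r * F (a - p)%N (b - q)%N (c - k)%N)%R).
Qed.

Lemma ps_mulC : commutative ps_mul.
Proof.
move=> F G; apply: ps_ext => a b c; rewrite /ps_mul.
rewrite (sum_ord_rev (fun i i' => \sum_(j < b.+1) \sum_(k < c.+1) F i j k * G i' (b - j)%N (c - k)%N)%R).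
apply: eq_bigr => i _.
rewrite (sum_ord_rev (fun j j' => \sum_(k < c.+1) F (a - i)%N j k * G i j' (c - k)%N)%R).
apply: eq_bigr => j _.
rewrite (sum_ord_rev (fun k k' => F (a - i)%N (b - j)%N k * G i j k')%R).
by apply: eq_bigr => k _; rewrite mulrC.
Qed.

Lemma ps_mulDl F G H : ps_mul (ps_add F G) H = ps_add (ps_mul F H) (ps_mul G H).
Proof.
apply: ps_ext => a b c; rewrite /ps_add /ps_mul.
do 3! (rewrite -big_split; apply: eq_bigr => ? _).
by rewrite mulrDl.
Qed.

Lemma ps_mulA : associative ps_mul.
Proof.
move=> F G H; apply: ps_ext => a b c; rewrite /ps_mul; symmetry.
pose f i i' i'' j j' j'' k k' k'' : int := (F i j k * (G i' j' k' * H i'' j'' k''))%R.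
(* The sums are interleaved so that the two indices belonging to one variable are adjacent and
   [sum_triangle] applies to each variable separately. *)
transitivity (\sum_(i < a.+1) \sum_(i' < i.+1) \sum_(j < b.+1) \sum_(j' < j.+1)
  \sum_(k < c.+1) \sum_(k' < k.+1) f i' (i - i')%N (a - i)%N j' (j - j')%N (b - j)%N k' (k - k')%N (c - k)%N)%R.
  apply: eq_bigr => i _; rewrite [RHS]exchange_big; apply: eq_bigr => j _ /=.
  under [RHS]eq_bigr do rewrite exchange_big.
  rewrite [RHS]exchange_big; apply: eq_bigr => k _ /=.
  do 3! (rewrite mulr_suml; apply: eq_bigr => ? _).
  by rewrite /f mulrA.
rewrite (sum_triangle (fun i i' i'' => \sum_(j < b.+1) \sum_(j' < j.+1)
  \sum_(k < c.+1) \sum_(k' < k.+1) f i i' i'' j' (j - j')%N (b - j)%N k' (k - k')%N (c - k)%N)%R).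
apply: eq_bigr => i _.
transitivity (\sum_(i' < (a - i).+1) \sum_(j < b.+1) \sum_(j' < (b - j).+1)
  \sum_(k < c.+1) \sum_(k' < (c - k).+1)
    f i i' (a - i - i')%N j j' (b - j - j')%N k k' (c - k - k')%N)%R.
  apply: eq_bigr => i' _.
  rewrite (sum_triangle (fun j j' j'' =>
   \sum_(k < c.+1) \sum_(k' < k.+1) f i i' (a - i - i')%N j j' j'' k' (k - k')%N (c - k)%N)%R).
  apply: eq_bigr => j _; apply: eq_bigr => j' _.
  exact: (sum_triangle (fun k k' k'' => f i i' (a - i - i')%N j j' (b - j - j')%N k k' k'')).
rewrite exchange_big; apply: eq_bigr => j _ /=.
under eq_bigr do rewrite exchange_big.
rewrite exchange_big; apply: eq_bigr => k _ /=.
by do 3! (rewrite mulr_sumr; apply: eq_bigr => ? _).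
Qed.

Lemma ps_mul1 F : ps_mul 1%:S%PS F = F.
Proof.
apply: ps_ext => a b c.
by rewrite -[1%:S%PS]/(ps_mon 1 0 0 0) ps_monM /= !subn0 mul1r.
Qed.

Lemma ps_ring_theory :
  ring_theory 0%:S%PS 1%:S%PS ps_add ps_mul ps_sub ps_opp (@eq ps).
Proof.
split.
- by move=> F; apply: ps_ext => a b c; rewrite /ps_add /ps_const if_same add0r.
- by move=> F G; apply: ps_ext => a b c; rewrite /ps_add addrC.
- by move=> F G H; apply: ps_ext => a b c; rewrite /ps_add addrA.
- exact: ps_mul1.
- exact: ps_mulC.
- exact: ps_mulA.
- exact: ps_mulDl.
- by [].
- by move=> F; apply: ps_ext => a b c; rewrite /ps_add /ps_const if_same addrN.
Qed.

Add Ring ps_ring : ps_ring_theory.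

(** This and the next three identities express the constants of [Bden] and [Bnum] through 1, for the
    use of [ring]. *)
Lemma ps_2 : 2%:S%PS = ps_add 1%:S%PS 1%:S%PS.
Proof. by apply: ps_ext => a b c; rewrite /ps_add /ps_const; case: ifP. Qed.

Lemma ps_3 : 3%:S%PS = ps_add 1%:S%PS 2%:S%PS.
Proof. by apply: ps_ext => a b c; rewrite /ps_add /ps_const; case: ifP. Qed.

Lemma ps_5 : 5%:S%PS = ps_add 2%:S%PS 3%:S%PS.
Proof. by apply: ps_ext => a b c; rewrite /ps_add /ps_const; case: ifP. Qed.

Lemma ps_4 : 4%:S%PS = ps_add 2%:S%PS 2%:S%PS.
Proof. by apply: ps_ext => a b c; rewrite /ps_add /ps_const; case: ifP. Qed.

(** * Generating functions *)

(* [L n] lists objects of size [n]; an object whose cycle type is (a, b, c) has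
   size a + 2b + 3c, so no other [L n] contributes to the coefficient. *)
Definition gf (L : nat -> seq (seq nat)) : ps :=
  fun a b c => Posz (count (has_cycle_type a b c) (L (a + 2 * b + 3 * c))).

Lemma gf_perm L M : (forall n, perm_eq (L n) (M n)) -> gf L = gf M.
Proof. by move=> h; apply: ps_ext => a b c; rewrite /gf (seq.permP (h _)). Qed.

Lemma gf_cat L M : gf (fun n => L n ++ M n) = ps_add (gf L) (gf M).
Proof. by apply: ps_ext => a b c; rewrite /gf /ps_add count_cat PoszD. Qed.

Lemma gf_empty : gf (fun n => if n is 0 then [:: [::]] else [::]) = 1%:S%PS.
Proof.
by apply: ps_ext => a b c; rewrite /gf /ps_const; case: a b c => [|a] [|b] [|c].
Qed.

Lemma gf_point : gf (fun n => if n is 1 then [:: revw 1] else [::]) = ps_t.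
Proof.
apply: ps_ext => a b c; rewrite /gf /ps_t; case: ifP => [/and3P[/eqP -> /eqP -> /eqP ->] //|h].
by case e : (a + 2 * b + 3 * c) => [|[|m]] //; move: h; lia.
Qed.

(** Adding a 2-cycle raises the size by 2 and the exponent of x by 1. For b = 0 both sides vanish,
    since every [phi w] has points on a 2-cycle. *)
Lemma gf_add2cycle (phi : seq nat -> seq nat) L :
    (forall n w k, w \in L n -> npoints k (phi w) = npoints k w + 2 * (k == 2)) ->
  gf (fun n => if n is m.+2 then map phi (L m) else [::]) = ps_mul ps_x (gf L).
Proof.
move=> h; apply: ps_ext => a b c; rewrite -[ps_x]/(ps_mon 1 0 1 0) ps_monM /= !subn0 mul1r andbT.
rewrite /gf; case: b => [|b]; last first.
  rewrite subn1 /= (_ : a + 2 * b.+1 + 3 * c = (a + 2 * b + 3 * c).+2); last by lia.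
  rewrite count_map; congr Posz; apply: eq_in_count => w hw /=.
  by rewrite /has_cycle_type !(h _ _ _ hw) /= !addn0 (_ : 2 * b.+1 = 2 * b + 2 * 1) ?eqn_add2r //; lia.
case: (a + 2 * 0 + 3 * c) => [|[|m]] //; rewrite count_map; apply/eqP.
rewrite eqz_nat -leqn0 leqNgt -has_count; apply/hasPn => w hw /=.
by rewrite /has_cycle_type (h _ _ 2 hw) /= addn2 andbF.
Qed.

(** The type [T] allows for words with a gap: [psi] forgets the gap, whereas [phi] uses it to place
    the new 3-cycle. *)
Lemma gf_add3cycle (T : eqType) (phi psi : T -> seq nat) (L : nat -> seq T) :
    (forall n w k, w \in L n -> npoints k (phi w) = npoints k (psi w) + 3 * (k == 3)) ->
  gf (fun n => if n is m.+3 then map phi (L m) else [::])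
  = ps_mul ps_y (gf (fun n => map psi (L n))).
Proof.
move=> h; apply: ps_ext => a b c; rewrite -[ps_y]/(ps_mon 1 0 0 1) ps_monM /= !subn0 mul1r.
rewrite /gf; case: c => [|c]; last first.
  rewrite subn1 /= (_ : a + 2 * b + 3 * c.+1 = (a + 2 * b + 3 * c).+3); last by lia.
  rewrite !count_map; congr Posz; apply: eq_in_count => w hw /=.
  by rewrite /has_cycle_type !(h _ _ _ hw) /= !addn0 (_ : 3 * c.+1 = 3 * c + 3 * 1) ?eqn_add2r //; lia.
case: (a + 2 * b + 3 * 0) => [|[|[|m]]] //; rewrite count_map; apply/eqP.
rewrite eqz_nat -leqn0 leqNgt -has_count; apply/hasPn => w hw /=.
by rewrite /has_cycle_type (h _ _ 3 hw) /= addn3 !andbF.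
Qed.

Lemma good_word_cycle_type n w : w \in good_words n -> exists i j l,
  [/\ n = i + 2 * j + 3 * l,
      npoints 1 w = i, npoints 2 w = 2 * j & npoints 3 w = 3 * l].
Proof.
move=> /good_wordsP[h1 h2 h3 h4]; have [s e] := word_surj h1 h2.
exists (ncycles 1 s), (ncycles 2 s), (ncycles 3 s).
rewrite -(mul1n (ncycles 1 s)) -!npoints_ncycles // e; split=> //.
by rewrite -[LHS]h2 -npoints_sum h4.
Qed.

Lemma sum_nat_delta n p (g : nat -> nat) :
  \sum_(i < n.+1) (i == p :> nat) * g i = (p <= n) * g p.
Proof.
rewrite (eq_bigr (fun i : 'I__ => if i == p :> nat then g i else 0)); last first.
  by move=> i _; case: eqP; rewrite ?mul1n.
by rewrite -big_mkcond big_ord1_eq ltnS; case: leqP; rewrite ?mul1n.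
Qed.

(** Cycle types add under direct sum, so at most one term on the right is nonzero, the one indexed
    by the cycle type of [u]. *)
Lemma has_cycle_type_dsum m n u v a b c : u \in good_words m -> v \in good_words n ->
  has_cycle_type a b c (dsum u v) = \sum_(i < a.+1) \sum_(j < b.+1) \sum_(k < c.+1)
    has_cycle_type i j k u * has_cycle_type (a - i) (b - j) (c - k) v :> nat.
Proof.
move=> hu hv.
have [i0 [j0 [k0 [_ u1 u2 u3]]]] := good_word_cycle_type hu.
have [i1 [j1 [k1 [_ v1 v2 v3]]]] := good_word_cycle_type hv.
have /good_wordsP[pu _ _ _] := hu; have /good_wordsP[pv _ _ _] := hv.
transitivity (\sum_(i < a.+1) (i == i0 :> nat) * (\sum_(j < b.+1) (j == j0 :> nat) *
   (\sum_(k < c.+1) (k == k0 :> nat) * [&& i1 == a - i, j1 == b - j & k1 == c - k])));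
  last first.
  apply: eq_bigr => i _; rewrite big_distrr; apply: eq_bigr => j _ /=.
  rewrite !big_distrr; apply: eq_bigr => k _ /=.
  rewrite /has_cycle_type u1 u2 u3 v1 v2 v3 !eqn_pmul2l // !mulnA !mulnb.
  by congr nat_of_bool; lia.
rewrite (sum_nat_delta _ _ (fun i => \sum_(j < b.+1) (j == j0 :> nat) *
   (\sum_(k < c.+1) (k == k0 :> nat) * [&& i1 == a - i, j1 == b - j & k1 == c - k]))).
rewrite (sum_nat_delta _ _ (fun j =>
   (\sum_(k < c.+1) (k == k0 :> nat) * [&& i1 == a - i0, j1 == b - j & k1 == c - k]))).
rewrite (sum_nat_delta _ _ (fun k => nat_of_bool [&& i1 == a - i0, j1 == b - j0 & k1 == c - k])).
rewrite /has_cycle_type !dsum_npoints // u1 u2 u3 v1 v2 v3 !mulnb -!mulnDr !eqn_pmul2l //.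
by congr nat_of_bool; lia.
Qed.

Lemma count_good_words0 n L i j k : {subset L <= good_words n} ->
  n != i + 2 * j + 3 * k -> count (has_cycle_type i j k) L = 0.
Proof.
move=> hL hn; apply/eqP; rewrite -leqn0 leqNgt -has_count; apply/hasPn => w /hL.
move=> /good_word_cycle_type[i0 [j0 [k0 [e h1 h2 h3]]]]; apply: contra hn.
by rewrite /has_cycle_type h1 h2 h3 e; lia.
Qed.

(** A direct sum is split both by the size of its first summand and by the cycle type of that
    summand; the type determines the size, so the sum over sizes collapses to the Cauchy product. *)
Lemma gf_dsum_conv L M :
    (forall n, {subset L n <= good_words n}) -> (forall n, {subset M n <= good_words n}) ->
  gf (dsum_conv L M) = ps_mul (gf L) (gf M).
Proof.
move=> hL hM; apply: ps_ext => a b c; rewrite /gf /ps_mul.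
set n := a + 2 * b + 3 * c.
transitivity (Posz (\sum_(i < a.+1) \sum_(j < b.+1) \sum_(k < c.+1)
  count (has_cycle_type i j k) (L (i + 2 * j + 3 * k))
  * count (has_cycle_type (a - i) (b - j) (c - k)) (M ((a - i) + 2 * (b - j) + 3 * (c - k))))); last first.
  by do 3! (rewrite (big_morph Posz PoszD (erefl _)); apply: eq_bigr => ? _).
congr Posz.
transitivity (\sum_(0 <= m < n.+1) \sum_(u <- L m) \sum_(v <- M (n - m)) has_cycle_type a b c (dsum u v)).
  rewrite /dsum_conv -sum1_count big_mkcond big_allpairs_dep /index_iota subn0.
  apply: eq_bigr => m _; rewrite big_allpairs.
  by apply: eq_bigr => u _; apply: eq_bigr => v _; case: has_cycle_type.
transitivity (\sum_(0 <= m < n.+1) \sum_(i < a.+1) \sum_(j < b.+1) \sum_(k < c.+1)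
   count (has_cycle_type i j k) (L m) * count (has_cycle_type (a - i) (b - j) (c - k)) (M (n - m))).
  apply: eq_bigr => m _.
  rewrite (eq_big_seq (fun u => \sum_(v <- M (n - m)) \sum_(i < a.+1) \sum_(j < b.+1)
     \sum_(k < c.+1) has_cycle_type i j k u * has_cycle_type (a - i) (b - j) (c - k) v)); last first.
    move=> u /hL hu; apply: eq_big_seq => v /hM hv; exact: (has_cycle_type_dsum _ _ _ hu hv).
  under eq_bigr do rewrite exchange_big.
  rewrite exchange_big; apply: eq_bigr => i _ /=.
  under eq_bigr do rewrite exchange_big.
  rewrite exchange_big; apply: eq_bigr => j _ /=.
  under eq_bigr do rewrite exchange_big.
  rewrite exchange_big; apply: eq_bigr => k _ /=.
  rewrite -!sum1_count !(big_mkcond (has_cycle_type _ _ _)) big_distrlr /=.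
  by apply: eq_bigr => u _; apply: eq_bigr => v _; do 2! case: has_cycle_type.
rewrite exchange_big; apply: eq_bigr => i _; rewrite exchange_big; apply: eq_bigr => j _.
rewrite exchange_big; apply: eq_bigr => k _ /=.
have hi := ltn_ord i; have hj := ltn_ord j; have hk := ltn_ord k.
(* Only this size is compatible with a first summand of type (i, j, k). *)
rewrite (bigD1_seq (i + 2 * j + 3 * k)) ?iota_uniq //=; last first.
  by rewrite mem_index_iota /n; lia.
rewrite big1 ?addn0.
  by congr (_ * count _ (M _)); rewrite /n; lia.
by move=> m hm; rewrite (@count_good_words0 m) ?mul0n // => w; apply: hL.
Qed.

(** * The functional equations *)

Definition rev_words (n : nat) : seq (seq nat) := if n is 0 then [::] else [:: revw n].

Lemma rev_words_good n : {subset rev_words n <= good_words n}.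
Proof. by case: n => // n w; rewrite inE => /eqP ->; apply: revw_good. Qed.

Lemma gf_revw_split : gf (fun n => [:: revw n]) = ps_add 1%:S%PS (gf rev_words).
Proof. by rewrite -gf_empty -gf_cat; apply: gf_perm => -[|n] //=. Qed.

(** The extreme cuts 0 and [m] contribute nothing, because [rev_words 0] is empty. *)
Lemma dsum_conv_rev_words m : dsum_conv rev_words rev_words m =
  [seq dsum (revw a) (revw (m - a)) | a <- iota 1 m.-1].
Proof.
case: m => [|m] //; rewrite /dsum_conv.
have -> : iota 0 m.+2 = 0 :: iota 1 m ++ [:: m.+1].
  by rewrite -[_ :: _]/(iota 0 1 ++ iota 1 m ++ iota (1 + m) 1) -!iotaD addn1.
rewrite map_cons map_cat /= flatten_cat subnn /= cats0.
rewrite -[RHS]flatten_seq1 -map_comp; congr flatten; apply/eq_in_map => a.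
rewrite mem_iota => /andP[h1 h2] /=.
have [k ek] : exists k, a = k.+1 by exists a.-1; lia.
have [l el] : exists l, m.+1 - a = l.+1 by exists (m - a); lia.
by rewrite el ek.
Qed.

(** Sizes 0 and 1 give 1 + t; any larger decreasing word is a smaller one enclosed in a 2-cycle. *)
Lemma gf_revw_rec :
  gf (fun n => [:: revw n]) =
  ps_add (ps_add 1%:S%PS ps_t) (ps_mul ps_x (gf (fun n => [:: revw n]))).
Proof.
rewrite -(@gf_add2cycle (fun w => revw (size w).+2)) -?gf_empty -?gf_point -?gf_cat.
  by apply: gf_perm => -[|[|n]] //=; rewrite size_revw.
by move=> n w k; rewrite inE => /eqP ->; rewrite size_revw revw_npointsSS.
Qed.

(** The n+1 copies stand for the possible gaps. Size n+2 has n+3 of them, namely the n+1 of size n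
    and two more, hence M + 2 R; the two gaps in size 1 give 2 t. *)
Lemma gf_revw_gaps_rec :
  gf (fun n => nseq n.+1 (revw n)) =
  ps_add (ps_add (ps_add 1%:S%PS ps_t) ps_t)
    (ps_mul ps_x (ps_add (ps_add (gf (fun n => nseq n.+1 (revw n))) (gf (fun n => [:: revw n])))
                         (gf (fun n => [:: revw n])))).
Proof.
rewrite -!gf_cat -(@gf_add2cycle (fun w => revw (size w).+2)) -?gf_empty -?gf_point -?gf_cat.
  apply: gf_perm => -[|[|n]] //; rewrite !map_cat map_nseq /= size_revw.
  by apply/seq.permP => P; rewrite /= !count_cat /= count_nseq; lia.
move=> n w k; rewrite !mem_cat mem_nseq !inE /= !orbb => /eqP ->.
by rewrite size_revw revw_npointsSS.
Qed.

Lemma gf_pairs :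
  gf (fun n => map fst (good_pairs n)) =
  ps_add (ps_add (gf (fun n => nseq n.+1 (revw n))) (ps_mul (gf rev_words) (gf rev_words)))
   (ps_add (ps_mul ps_y (gf (fun n => map fst (good_pairs n))))
           (ps_mul ps_y (gf (fun n => map fst (good_pairs n))))).
Proof.
rewrite -!(@gf_add3cycle _ ext_pair); last first.
  move=> n [w p] k /good_pairsP[/good_wordsP[h1 h2 _ _] h5 _].
  by apply: ext_npoints => //; rewrite h2.
rewrite -gf_dsum_conv; [|exact: rev_words_good|exact: rev_words_good].
rewrite -!gf_cat; apply: gf_perm => m.
apply: perm_trans (perm_map fst (good_pairs_perm m)) _.
rewrite !map_cat -!map_comp dsum_conv_rev_words -catA.
have -> : forall (T : eqType) (w : T), map (fst \o pair w) (iota 0 m.+1) = nseq m.+1 w.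
  by move=> T w; elim: m.+1 (0) => //= k IH i; rewrite IH.
by case: m => [|[|[|m]]] //; rewrite !map_cat -!map_comp.
Qed.

Lemma gf_blocks :
  gf blocks = ps_add (gf rev_words) (ps_mul ps_y (gf (fun n => map fst (good_pairs n)))).
Proof.
rewrite -(@gf_add3cycle _ ext_pair) -?gf_cat //.
move=> n [w p] k /good_pairsP[/good_wordsP[h1 h2 _ _] h5 _].
by apply: ext_npoints => //; rewrite h2.
Qed.

Lemma gf_good_words :
  gf good_words = ps_add 1%:S%PS (ps_mul (gf good_words) (gf blocks)).
Proof.
have hb n : {subset blocks n <= good_words n} by move=> w /blocksP[].
by rewrite -(gf_dsum_conv (fun n w => id) hb) -gf_empty -gf_cat; apply: gf_perm good_words_perm.
Qed.

(** * Solution of the system and the closed form *)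

Local Open Scope ps_scope.

(** No series is inverted: each unknown is multiplied by its denominator, built from 1 - x and 1 -
    2y, which leaves polynomial identities. *)
Lemma ps_solve (A J R D M : ps) :
    A = 1%:S + A * J -> J = R - 1%:S + ps_y * D ->
    D = M + (R - 1%:S) * (R - 1%:S) + (ps_y * D + ps_y * D) ->
    R = 1%:S + ps_t + ps_x * R ->
    M = 1%:S + ps_t + ps_t + ps_x * (M + R + R) ->
  A * Bden = Bnum.
Proof.
move=> hA hJ hD hR hM; rewrite /Bden /Bnum ps_5 ps_4 ps_3 ps_2.
move: ps_x ps_t ps_y hA hJ hD hR hM => x t y hA hJ hD hR hM.
have eR : (1%:S - x) * R = 1%:S + t.
  transitivity (R - x * R); first by ring.
  by rewrite {1}hR; ring.
have eM : (1%:S - x) * (1%:S - x) * M =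
    (1%:S - x) * (1%:S + t + t) + x * (1%:S + t + (1%:S + t)).
  transitivity ((1%:S - x) * (M - x * M)); first by ring.
  by rewrite {1}hM -eR; ring.
have eD : (1%:S - x) * (1%:S - x) * (1%:S - y - y) * D =
    1%:S + t + t + x + (x + t) * (x + t).
  transitivity ((1%:S - x) * (1%:S - x) * (D - (y * D + y * D))); first by ring.
  rewrite {1}hD.
  transitivity ((1%:S - x) * (1%:S - x) * M
    + ((1%:S - x) * R - (1%:S - x)) * ((1%:S - x) * R - (1%:S - x))); first by ring.
  by rewrite eM eR; ring.
have eJ : (1%:S - x) * (1%:S - x) * (1%:S - y - y) * J =
    (t + x) * (1%:S - x) * (1%:S - y - y) + y * (1%:S + t + t + x + (x + t) * (x + t)).
  rewrite -eD hJ.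
  transitivity (((1%:S - x) * R - (1%:S - x)) * (1%:S - x) * (1%:S - y - y)
     + y * ((1%:S - x) * (1%:S - x) * (1%:S - y - y) * D)); first by ring.
  by rewrite eR; ring.
(* [Bden] equals (1-x)^2 (1-2y) (1-J), while A - A J = 1, so this product is both sides at once. *)
transitivity ((A - A * J) * ((1%:S - x) * (1%:S - x) * (1%:S - y - y))); last first.
  by rewrite {1}hA; ring.
transitivity (A * ((1%:S - x) * (1%:S - x) * (1%:S - y - y)
   - (1%:S - x) * (1%:S - x) * (1%:S - y - y) * J)); last by ring.
by rewrite eJ; ring.
Qed.

(* B = Bnum / Bden as formal power series; Bden has constant term 1, hence is
   invertible, so this is equivalent to B * Bden = Bnum. *)
Theorem theorem3p1 : ps_mul B Bden = Bnum.
Proof.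
have -> : B = gf good_words by apply: ps_ext => a b c; rewrite /B Bcoef_count.
have eR : gf rev_words = ps_sub (gf (fun n => [:: revw n])) 1%:S%PS.
  by rewrite gf_revw_split; ring.
apply: (ps_solve gf_good_words _ _ gf_revw_rec gf_revw_gaps_rec).
- by rewrite -eR gf_blocks.
- by rewrite -eR -gf_pairs.
Qed.
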